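(* Let $M_1^R$ be a timelike right helicoidal surface of type I in $\mathbb{E}^n_1$ ($n\ge 3$), parametrized by $H_1^R(u,v)=(x_1(u)\cos v,x_1(u)\sin v,x_3(u),\dots,x_{n-1}(u),x_{n_0}+cv)$ where $c\ne0$ and $x_{n_0}$ are constants. Let $\alpha_1^R$ be a timelike loxodrome on $M_1^R$ with constant angle $\phi_0>0$ and with $\dot u\neq0$ everywhere. Then $\alpha_1^R$ can be parametrized by $\alpha_1^R(u)=H_1^R(u,v(u))$ where, up to an additive constant in $v$ and with one fixed choice of sign, $$v(u)=\pm\coth\phi_0\int_{u_0}^u\frac{d\xi}{\sqrt{c^2-x_1^2(\xi)}}.$$
   Context: $\mathbb{E}^n_1$ is $\mathbb{R}^n$ with the metric $\langle\cdot,\cdot\rangle$ given by $dx_1^2+\cdots+dx_{n-1}^2-dx_n^2$, and $\|w\|=\sqrt{|\langle w,w\rangle|}$. A vector $w$ is spacelike if $\langle w,w\rangle>0$ or $w=0$, timelike if $\langle w,w\rangle<0$; a curve is timelike if its velocity is timelike everywhere. Here $I\subset\mathbb{R}$ is an open interval, and the profile curve $u\mapsto(x_1(u),0,x_3(u),\dots,x_{n-1}(u),x_{n_0})$, $u\in I$, is smooth, regular and parametrized by arc length, i.e. $x_1'^2+x_3'^2+\cdots+x_{n-1}'^2=\varepsilon$ with $\varepsilon\in\{1,-1\}$ (the last coordinate being constant; this is what ''right'' means). The formula for $H_1^R$ is used for all real $v$. The surface is timelike if $EG-F^2<0$ everywhere, where $E,F,G$ are the coefficients of the induced metric $E\,du^2+2F\,du\,dv+G\,dv^2$.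 The meridians are the curves $u\mapsto H_1^R(u,v_0)$ with $v_0$ constant. Lorentzian angle: for $x$ nonzero spacelike and $y$ timelike, the angle is the unique $\theta\ge0$ with $\langle x,y\rangle=\pm\|x\|\|y\|\sinh\theta$; for $x,y$ both timelike, it is the unique $\theta\ge 0$ with $\langle x,y\rangle=\pm\|x\|\|y\|\cosh\theta$. A timelike loxodrome with constant angle $\phi_0$ is a smooth timelike curve $\alpha(t)=H_1^R(u(t),v(t))$, $t$ in an open interval, such that, for every $t$, the Lorentzian angle between $\dot\alpha(t)$ and the meridian tangent vector $(H_1^R)_u(u(t),v(t))$ equals $\phi_0$. The number $u_0$ is any point in the range of $u(t)$. *)

(* Defs.v *)
From HB Require Import structures.
From mathcomp Require Import all_boot all_order all_algebra.
From mathcomp Require Import all_classical all_reals all_analysis.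

Set Implicit Arguments.
Unset Strict Implicit.
Unset Printing Implicit Defensive.

Import Order.TTheory GRing.Theory Num.Theory.
Import numFieldNormedType.Exports.

Local Open Scope ring_scope.
Local Open Scope classical_set_scope.


Section Analysis.
Context {R : realType}.

Definition open_interval (I : set R) : Prop :=
  [/\ open I, is_interval I & I !=set0].

(* Meant for open [A]: the derivatives are two-sided. *)
Definition smooth_on {V : normedModType R} (A : set R) (f : R -> V) : Prop :=
  forall (k : nat) (x : R), A x -> derivable (derive1n k f) x 1.

Definition sinh (x : R) : R := (expR x - expR (- x)) / 2.
Definition cosh (x : R) : R := (expR x + expR (- x)) / 2.
Definition coth (x : R) : R := cosh x / sinh x.

(* The integral from [a] to [b], with a minus sign when b < a. *)
Definition oriented_integral (a b : R) (f : R -> R) : R :=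
  if a <= b then \int[lebesgue_measure]_(x in `[a, b]) f x
  else - \int[lebesgue_measure]_(x in `[b, a]) f x.

(* [tau] is the smooth inverse, defined on J, of the smooth map u : T -> J. *)
Definition change_of_parameter (T J : set R) (u tau : R -> R) : Prop :=
  [/\ smooth_on T u, smooth_on J tau,
      forall t, T t -> J (u t) /\ tau (u t) = t
    & forall w, J w -> T (tau w) /\ u (tau w) = w].

End Analysis.

Section Minkowski.
Context {R : realType} {n : nat}.
Implicit Types w x y : 'rV[R]_n.

Definition lorentz x y : R :=
  \sum_(i < n) (if i.+1 == n then -1 else 1) * x 0 i * y 0 i.

Definition lorentz_norm w : R := Num.sqrt `|lorentz w w|.

Definition spacelike w : Prop := 0 < lorentz w w \/ w = 0.
Definition timelike w : Prop := lorentz w w < 0.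

Definition lorentz_angle x y (theta : R) : Prop :=
  0 <= theta /\
  ((spacelike x /\ x != 0 /\ timelike y /\
     (lorentz x y = lorentz_norm x * lorentz_norm y * sinh theta \/
      lorentz x y = - (lorentz_norm x * lorentz_norm y * sinh theta)))
   \/
   (timelike x /\ timelike y /\
     (lorentz x y = lorentz_norm x * lorentz_norm y * cosh theta \/
      lorentz x y = - (lorentz_norm x * lorentz_norm y * cosh theta)))).

Definition timelike_curve (T : set R) (alpha : R -> 'rV[R]_n) : Prop :=
  forall t, T t -> timelike (derive1 alpha t).

Section Surface.
Variable H : R -> R -> 'rV[R]_n.

Definition partial_u (u v : R) : 'rV[R]_n := derive1 (H ^~ v) u.
Definition partial_v (u v : R) : 'rV[R]_n := derive1 (H u) v.

Definition coefE u v : R := lorentz (partial_u u v) (partial_u u v).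
Definition coefF u v : R := lorentz (partial_u u v) (partial_v u v).
Definition coefG u v : R := lorentz (partial_v u v) (partial_v u v).

Definition timelike_surface (I : set R) : Prop :=
  forall u v, I u -> coefE u v * coefG u v - coefF u v ^+ 2 < 0.

(* The curve is t |-> H (u t) (v t); the meridians are the u-curves of H. *)
Definition timelike_loxodrome (I T : set R) (u v : R -> R) (phi0 : R) : Prop :=
  [/\ open_interval T,
      smooth_on T u /\ smooth_on T v,
      forall t, T t -> I (u t),
      timelike_curve T (fun t => H (u t) (v t))
    & forall t, T t ->
        lorentz_angle (partial_u (u t) (v t))
                      (derive1 (fun s => H (u s) (v s)) t) phi0].

End Surface.
End Minkowski.

Section Helicoidal.
Context {R : realType}.
Variables (n : nat) (x : nat -> R -> R) (xn0 : R).

(* Coordinates are numbered from 1: the entry of index i : 'I_n is the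
   coordinate x_(i+1). The functions x 2 and x n are not used. *)
Definition profile (u : R) : 'rV[R]_n :=
  \row_(i < n) (if i.+1 == 2%N then 0
                else if i.+1 == n then xn0
                else x i.+1 u).

Definition arclength_profile (I : set R) (eps : R) : Prop :=
  [/\ smooth_on I profile,
      forall u, I u -> derive1 profile u != 0
    & forall u, I u ->
        derive1 (x 1%N) u ^+ 2 + \sum_(3 <= k < n) derive1 (x k) u ^+ 2 = eps].

Definition helicoidal (c u v : R) : 'rV[R]_n :=
  \row_(i < n) (if i.+1 == 1%N then x 1%N u * cos v
                else if i.+1 == 2%N then x 1%N u * sin v
                else if i.+1 == n then xn0 + c * v
                else x i.+1 u).

End Helicoidal.

(* Main.v *)
Require Import Defs.
From HB Require Import structures.
From mathcomp Require Import all_boot all_order all_algebra.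
From mathcomp Require Import all_classical all_reals all_analysis.
From mathcomp Require Import ring lra.
Import Order.TTheory GRing.Theory Num.Theory.
Import numFieldNormedType.Exports.

Local Open Scope ring_scope.
Local Open Scope classical_set_scope.

(** In the frame of the u- and v-curves the metric is [E = 1] (the value [-1] is
    impossible for a sum of squares), [F = 0] and [G = x_1^2 - c^2 < 0].  With
    [F = 0] and the meridian tangent spacelike of norm 1, the angle condition reads
    [u'^2 cosh^2 phi_0 = (c^2 - x_1^2) v'^2 sinh^2 phi_0], so [v'/u'] equals
    [coth phi_0 / sqrt (c^2 - x_1^2)] up to a sign, which is constant because [v'/u']
    is continuous and never vanishes.  As [u' <> 0], [u] has a smooth inverse [tau] on
    the open interval [u(T)]; the derivative of [v o tau] is [v'/u'] at [tau], and the
    fundamental theorem of calculus concludes. *)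

(** * Closure properties of smooth functions on an open set *)

Section SmoothFunctions.
Context {R : realType}.
Implicit Types (A : set R) (f g : R -> R) (k : nat).

(** Finite-order version of [smooth_on]: derivability [k] times. It makes induction on the order
    possible, which the bootstrapping for inverse functions requires. *)
Definition diff_on A k f : Prop :=
  forall j x, (j < k)%N -> A x -> derivable (derive1n j f) x 1.

Lemma diff_on0 A f : diff_on A 0 f.
Proof. by move=> j x; rewrite ltn0. Qed.

Lemma diff_onS A k f :
  diff_on A k.+1 f <->
  (forall x, A x -> derivable f x 1) /\ diff_on A k (derive1 f).
Proof.
split=> [df|[df df'] [|j] x jk Ax]; last 2 first.
- exact: df.
- by rewrite derive1Sn; exact: df'.
- split=> [x Ax|j x jk Ax]; first exact: (df 0%N).
  by rewrite -derive1Sn; exact: df.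
Qed.

Lemma diff_onW A k f : diff_on A k.+1 f -> diff_on A k f.
Proof. by move=> df j x jk; apply: df; exact: ltnW. Qed.

Lemma smooth_onP A f : smooth_on A f <-> forall k, diff_on A k f.
Proof.
by split=> [df k j x _ Ax|df k x Ax]; [exact: df|exact: (df k.+1)].
Qed.

Lemma near_open A (P : R -> Prop) x :
  open A -> A x -> (forall y, A y -> P y) -> \forall y \near x, P y.
Proof.
by move=> oA Ax AP; have := open_nbhs_nbhs (conj oA Ax); exact: filterS.
Qed.

(** Differentiation rules give formulas valid on [A] only; openness turns equality on [A] into
    equality near each point, which derivatives respect. *)
Lemma eq_diff_on A k f g : open A -> {in A, f =1 g} ->
  diff_on A k f -> diff_on A k g.
Proof.
move=> oA; elim: k f g => [|k IH] f g fg; first by move=> *; exact: diff_on0.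
move=> /diff_onS[df df'].
have nfg x : A x -> \near x, f x = g x.
  by move=> Ax; apply: (near_open _ _ _ oA Ax) => y Ay; apply: fg; rewrite inE.
apply/diff_onS; split=> [x Ax|].
  exact: (near_eq_derivable (nfg _ Ax) (df x Ax)).
apply: IH df' => x; rewrite inE => Ax.
by rewrite !derive1E; apply: near_eq_derive (nfg _ Ax).
Qed.

Lemma diff_onM A k f g : open A ->
  diff_on A k f -> diff_on A k g -> diff_on A k (fun x => f x * g x).
Proof.
have diff_onD : open A -> forall k f g,
    diff_on A k f -> diff_on A k g -> diff_on A k (fun x => f x + g x).
  move=> oA {}k {}f {}g.
  elim: k f g => [|k IH] f g; first by move=> *; exact: diff_on0.
  move=> /diff_onS[df df'] /diff_onS[dg dg'].
  apply/diff_onS; split=> [x Ax|]; first exact: derivableD (df x Ax) (dg x Ax).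
  apply: eq_diff_on (IH _ _ df' dg') => // x; rewrite inE => Ax.
  by rewrite !derive1E deriveD//; [exact: df|exact: dg].
move=> oA; elim: k f g => [|k IH] f g df0 dg0; first exact: diff_on0.
have [df df'] := (diff_onS _ _ _).1 df0.
have [dg dg'] := (diff_onS _ _ _).1 dg0.
apply/diff_onS; split=> [x Ax|]; first exact: derivableM (df x Ax) (dg x Ax).
have h := diff_onD oA k _ _ (IH _ _ (diff_onW _ _ _ df0) dg')
                            (IH _ _ (diff_onW _ _ _ dg0) df').
apply: eq_diff_on h => // x; rewrite inE => Ax.
by rewrite !derive1E deriveM//; [exact: df|exact: dg].
Qed.

(** The derivative [- f' / f^2] contains the inverse of [f] again, but one order lower, so the
    induction hypothesis and the product rule cover it. *)
Lemma diff_onV A k f : open A -> (forall x, A x -> f x != 0) ->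
  diff_on A k f -> diff_on A k (fun x => (f x)^-1).
Proof.
move=> oA f0; elim: k => [|k IH] df0; first exact: diff_on0.
have [df df'] := (diff_onS _ _ _).1 df0.
apply/diff_onS; split=> [x Ax|].
  by apply: derivableV; [exact: f0|exact: df].
have dV := IH (diff_onW _ _ _ df0).
have dN : diff_on A k (fun=> -1 : R).
  apply: (proj1 (smooth_onP A (fun=> -1 : R))) => j x _.
  have -> : derive1n j (fun=> -1 : R) = cst (if j is 0 then -1 else 0 : R).
    elim: j => [//|j IHj]; rewrite derive1nS IHj.
    by apply/funext => y; rewrite derive1_cst.
  exact: derivable_cst.
have h := diff_onM _ _ _ _ oA dN (diff_onM _ _ _ _ oA (diff_onM _ _ _ _ oA dV dV) df').
apply: eq_diff_on h => // x; rewrite inE => Ax.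
rewrite !derive1E deriveV; [|exact: f0|exact: df].
by rewrite mulN1r scaleNr -expr2 exprVn -derive1E.
Qed.

(** The chain rule replaces [f] by [f'], so the induction is general in [f]; smoothness of [f]
    survives this, while [g] may have order [k] only. *)
Lemma diff_on_comp A B k f g : open B ->
  (forall x, B x -> A (g x)) -> smooth_on A f -> diff_on B k g ->
  diff_on B k (f \o g).
Proof.
move=> oB gBA; elim: k f => [|k IH] f sf dg0; first exact: diff_on0.
have [dg dg'] := (diff_onS _ _ _).1 dg0.
have df x : B x -> derivable f (g x) 1 by move=> Bx; exact: (sf 0%N _ (gBA _ Bx)).
apply/diff_onS; split=> [x Bx|].
  apply/derivable1_diffP/differentiable_comp; apply/derivable1_diffP.
    exact: dg.
  exact: df.
have sf' : smooth_on A (derive1 f).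
  by move=> j x Ax; rewrite -derive1Sn; exact: (sf j.+1).
have h := diff_onM _ _ _ _ oB (IH _ sf' (diff_onW _ _ _ dg0)) dg'.
apply: eq_diff_on h => // x; rewrite inE => Bx.
by rewrite [RHS]derive1_comp; [|exact: dg|exact: df].
Qed.

(* Bootstrapping: [g' = 1 / (f' o g)] is as differentiable as [g]. *)
Lemma smooth_inverse A B f g : open B -> smooth_on A f ->
  (forall x, A x -> derive1 f x != 0) -> (forall y, B y -> A (g y)) ->
  (forall y, B y -> is_derive y 1 g (derive1 f (g y))^-1) ->
  smooth_on B g.
Proof.
move=> oB sf f0 gBA dg; apply/smooth_onP; elim=> [|k IH]; first exact: diff_on0.
apply/diff_onS; split=> [y By|]; first by have [] := dg y By.
have sf' : smooth_on A (derive1 f).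
  by move=> j x Ax; rewrite -derive1Sn; exact: (sf j.+1).
have h := diff_onV _ _ _ oB (fun y By => f0 _ (gBA y By))
  (diff_on_comp _ _ _ _ _ oB gBA sf' IH).
apply: eq_diff_on h => // y; rewrite inE => By.
by rewrite [RHS]derive1E; have [_ ->] := dg y By.
Qed.

End SmoothFunctions.

(** * Intermediate values, integration and inverse functions on intervals *)

Section RealFunctions.
Context {R : realType}.
Implicit Types (A : set R) (f g : R -> R).

Lemma continuous_image_interval A f : is_interval A ->
  (forall x, A x -> {for x, continuous f}) -> is_interval (f @` A).
Proof.
move=> iA cf; apply/connected_intervalP/connected_continuous_connected.
  exact/connected_intervalP.
by apply: continuous_in_subspaceT => x; rewrite inE; exact: cf.
Qed.

(** If [f] took both signs, its image, being an interval, would contain [0]. *)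
Lemma interval_constant_sign A f : is_interval A ->
  (forall x, A x -> {for x, continuous f}) -> (forall x, A x -> f x != 0) ->
  (forall x, A x -> 0 < f x) \/ (forall x, A x -> f x < 0).
Proof.
move=> iA cf f0; have ifA := continuous_image_interval _ _ iA cf.
have [[x Ax fx]|n] := pselect (exists2 x, A x & f x < 0); [right|left]; last first.
  move=> x Ax; rewrite lt_neqAle eq_sym f0//= leNgt.
  by apply/negP => fx; apply: n; exists x.
move=> y Ay; rewrite ltNge; apply/negP => fy.
have [|z Az fz] := ifA (f x) (f y) (imageP _ Ax) (imageP _ Ay) 0.
  by rewrite (ltW fx).
by have := f0 z Az; rewrite fz eqxx.
Qed.

Lemma derivable_continuous_at f x : derivable f x 1 -> {for x, continuous f}.
Proof. by move/derivable1_diffP; exact: differentiable_continuous. Qed.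

Lemma derive1_neq0_inj A f : is_interval A ->
  (forall x, A x -> derivable f x 1) -> (forall x, A x -> derive1 f x != 0) ->
  {in A &, injective f}.
Proof.
move=> iA df f0.
have lt_neq x y : A x -> A y -> x < y -> f x <> f y.
  move=> Ax Ay xy fxy.
  have Axy z : z \in `[x, y]%R -> A z by rewrite in_itv/=; exact: iA.
  have [z||z zxy [dfz]] := Rolle xy _ _ fxy.
  - by move=> /subset_itv_oo_cc /Axy; exact: df.
  - by apply: derivable_within_continuous => z /Axy; exact: df.
  by move=> e; have := f0 z (Axy _ (subset_itv_oo_cc zxy)); rewrite derive1E e eqxx.
move=> x y; rewrite !inE => Ax Ay fxy.
by case: (ltgtP x y) => [/lt_neq|/lt_neq|//] h; exfalso; apply: h.
Qed.

(** The case of increasing bounds suffices: swapping the bounds changes the sign of both sides, and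
    equal bounds leave an integral over a point. *)
Lemma oriented_integral_FTC A f F a b : is_interval A ->
  (forall x, A x -> {for x, continuous f}) ->
  (forall x, A x -> is_derive x 1 F (f x)) -> A a -> A b ->
  oriented_integral a b f = F b - F a.
Proof.
move=> iA cf dF.
have ftc p q : A p -> A q -> p < q ->
    \int[lebesgue_measure]_(x in `[p, q]) f x = F q - F p.
  move=> Ap Aq pq.
  have Apq z : z \in `[p, q]%R -> A z by rewrite in_itv/=; exact: iA.
  have dFz z : z \in `[p, q]%R -> derivable F z 1 by move=> /Apq /dF[].
  have cFz z : z \in `[p, q]%R -> {for z, continuous F}.
    by move=> /dFz; exact: derivable_continuous_at.
  rewrite /Rintegral (@continuous_FTC2 _ f F)//.
  - apply: continuous_in_subspaceT => z; rewrite inE => /Apq; exact: cf.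
  - split=> [z /subset_itv_oo_cc /dFz //||].
      apply: cvg_at_right_filter; apply: cFz.
      by rewrite in_itv/= lexx ltW.
    apply: cvg_at_left_filter; apply: cFz.
    by rewrite in_itv/= lexx ltW.
  - by move=> z /subset_itv_oo_cc /Apq Az; rewrite derive1E; have [_ ->] := dF z Az.
rewrite /oriented_integral => Aa Ab; case: ltgtP => [ab|ba|<-].
- exact: ftc.
- by rewrite ftc// opprB.
- by rewrite set_itv1 Rintegral_set1 subrr.
Qed.

(** Injectivity on the whole interval, from Rolle's theorem, makes the local inverses fit together
    into a global one. *)
Lemma inverse_change_of_parameter A f : open_interval A -> smooth_on A f ->
  (forall x, A x -> derive1 f x != 0) ->
  exists g : R -> R,
    [/\ open_interval (f @` A), change_of_parameter A (f @` A) f g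
      & forall x, A x -> is_derive (f x) 1 g (derive1 f x)^-1].
Proof.
move=> [oA iA A0] sf f0.
have df x : A x -> derivable f x 1 by exact: (sf 0%N).
have cf x : A x -> {for x, continuous f}.
  by move=> /df; exact: derivable_continuous_at.
have injf := derive1_neq0_inj _ _ iA df f0.
(* Off the image of [A] the value is the default [0]; the image is shown open below, so derivatives
   at its points do not see this value. *)
pose g y := xget 0 [set x | A x /\ f x = y].
have gK x : A x -> g (f x) = x.
  move=> Ax; rewrite /g; have [Az /injf] :=
    @xgetPex _ 0 [set z | A z /\ f z = f x] (ex_intro _ x (conj Ax erefl)).
  by apply; rewrite inE.
have near_can x : A x -> {near x, cancel f g}.
  by move=> Ax; exact: (near_open _ _ _ oA Ax).
have near_cont x : A x -> {near x, continuous f}.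
  by move=> Ax; exact: (near_open _ _ _ oA Ax).
have dg x : A x -> is_derive (f x) 1 g (derive1 f x)^-1.
  move=> Ax; apply: is_derive_inverse (near_can _ Ax) (near_cont _ Ax) _ (f0 _ Ax).
  by rewrite derive1E; exact/derivableP/df.
(* Near [f x] the continuous [g] stays in the open set [A] and satisfies [f (g y) = y], so every
   such [y] is in the image. *)
have oB : open (f @` A).
  rewrite openE => _ [x Ax <-]; rewrite /interior.
  have cg := nbhs_singleton (near_can_continuous (near_can _ Ax) (near_cont _ Ax)).
  have Ag : \forall y \near f x, A (g y).
    by apply: cg; rewrite gK//; exact: open_nbhs_nbhs.
  have := near_continuous_can_sym (near_cont _ Ax) (near_can _ Ax).
  by apply: filterS2 Ag => y Agy fgy; exists (g y).
have gBA y : (f @` A) y -> A (g y) /\ f (g y) = y.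
  by move=> [x Ax <-]; rewrite gK.
exists g; split=> //.
- by split=> //; [exact: continuous_image_interval|have [x Ax] := A0; exists (f x), x].
- split=> //; last by move=> x Ax; split; [exists x|exact: gK].
  apply: smooth_inverse sf f0 _ _ => // y By; first by have [] := gBA y By.
  have [Agy fgy] := gBA y By.
  by rewrite -[X in is_derive X _ _ _]fgy; exact: dg.
Qed.

End RealFunctions.

(** * The Lorentz form in coordinates *)

Section LorentzForm.
Context {R : realType} {n : nat}.
Implicit Types X Y Z : 'rV[R]_n.

Lemma lorentzC X Y : lorentz X Y = lorentz Y X.
Proof. by apply: eq_bigr => i _; rewrite mulrAC. Qed.

Lemma lorentzDZr X Y Z (a b : R) :
  lorentz X (a *: Y + b *: Z) = a * lorentz X Y + b * lorentz X Z.
Proof.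
rewrite /lorentz !mulr_sumr -big_split; apply: eq_bigr => i _ /=.
by rewrite !mxE; ring.
Qed.

(** The splitting follows the surface: coordinates 1 and 2 are rotated, coordinate [n] is timelike,
    and the middle sum, empty when [n = 3], is the one in [arclength_profile]. *)
Lemma lorentz_row (p q : nat -> R) : (3 <= n)%N ->
  lorentz (\row_(i < n) p i.+1) (\row_(i < n) q i.+1) =
  p 1%N * q 1%N + p 2%N * q 2%N + \sum_(3 <= k < n) p k * q k - p n * q n.
Proof.
move=> n3; rewrite /lorentz.
under eq_bigr do rewrite !mxE.
transitivity (\sum_(1 <= k < n.+1) (if k == n then -1 else 1) * p k * q k).
  by rewrite big_add1 big_mkord.
rewrite big_ltn ?ltnS ?(leq_trans _ n3)// big_ltn ?ltnS ?(leq_trans _ n3)//.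
rewrite big_nat_recr//= eqxx !ifN; [|by rewrite neq_ltn n3|].
  rewrite (eq_big_nat _ _ (F2 := fun k => p k * q k)); last first.
    by move=> k /andP[_ kn]; rewrite ifN ?mul1r// neq_ltn kn.
  ring.
by rewrite neq_ltn (leq_trans _ n3).
Qed.

End LorentzForm.

(** * Hyperbolic functions *)

Section HyperbolicFunctions.
Context {R : realType}.
Implicit Type x : R.

Lemma sinh_gt0 x : 0 < x -> 0 < sinh x.
Proof.
by move=> x0; rewrite divr_gt0// subr_gt0 ltr_expR; lra.
Qed.

Lemma cosh_gt0 x : 0 < cosh x.
Proof. by rewrite divr_gt0// addr_gt0// expR_gt0. Qed.

Lemma cosh2Bsinh2 x : cosh x ^+ 2 - sinh x ^+ 2 = 1.
Proof.
have : expR x * expR (- x) = 1 by rewrite -expRD subrr expR0.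
rewrite /cosh /sinh => e; transitivity (expR x * expR (- x)); last exact: e.
by field.
Qed.

End HyperbolicFunctions.

(** * Tangent vectors and first fundamental form of the helicoidal surface *)

Lemma is_derive1_row (R : realType) (n : nat) (F : R -> 'rV[R]_n) (t : R)
    (d : 'I_n -> R) :
  (forall i, is_derive t 1 (fun s => F s 0 i) (d i)) ->
  derive1 F t = \row_i d i.
Proof.
move=> dF; have drv : derivable F t 1.
  by apply/derivable_mxP => i j; rewrite ord1; have [] := dF j.
rewrite derive1E derive_mx//; apply/rowP => i; rewrite !mxE.
by have [_ ->] := dF i.
Qed.

Section HelicoidalTangent.
Context {R : realType}.
Variables (n : nat) (x : nat -> R -> R) (xn0 c : R).
Hypothesis n3 : (3 <= n)%N.

(** Like [tangent_v] below, indexed by coordinate numbers starting from 1, so that [lorentz_row]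
    applies. *)
Definition tangent_u (w z : R) (k : nat) : R :=
  if k == 1%N then derive1 (x 1%N) w * cos z
  else if k == 2%N then derive1 (x 1%N) w * sin z
  else if k == n then 0 else derive1 (x k) w.

Definition tangent_v (w z : R) (k : nat) : R :=
  if k == 1%N then - (x 1%N w * sin z)
  else if k == 2%N then x 1%N w * cos z
  else if k == n then c else 0.

(** Smoothness of the profile says something about [x k] at these indices only: its second entry is
    [0] and its last is [xn0]. *)
Definition derivable_profile (w : R) : Prop :=
  forall k : nat, (0 < k < n)%N -> k != 2%N -> derivable (x k) w 1.

Lemma smooth_derivable_profile (A : set R) (w : R) :
  smooth_on A (profile n x xn0) -> A w -> derivable_profile w.
Proof.
move=> sp Aw [//|k] /= kn k2.
have kn' : (k < n)%N := ltnW kn.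
have := (derivable_mxP _ _ _).1 (sp 0%N w Aw) 0 (Ordinal kn').
rewrite /= (_ : (fun _ => _) = x k.+1)//.
by apply/funext => y; rewrite mxE /= (negPf k2) ifN// neq_ltn kn.
Qed.

(** One computation serves three times: with one of [u], [v] the identity and the other constant it
    yields the partial derivatives, and in general the velocity of the curve. *)
Lemma helicoidal_chain (u v : R -> R) (t du dv : R) :
  derivable_profile (u t) -> is_derive t 1 u du -> is_derive t 1 v dv ->
  derive1 (fun s => helicoidal n x xn0 c (u s) (v s)) t =
  du *: \row_(i < n) tangent_u (u t) (v t) i.+1 +
  dv *: \row_(i < n) tangent_v (u t) (v t) i.+1.
Proof.
move=> dx dut dvt.
have dxu (k : nat) : (0 < k < n)%N -> k != 2%N ->
    is_derive t 1 (x k \o u) (derive1 (x k) (u t) * du).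
  by move=> k0 k2; apply: is_derive1_comp; rewrite derive1E; exact/derivableP/dx.
have dx1 : is_derive t 1 (x 1%N \o u) (derive1 (x 1%N) (u t) * du).
  by apply: dxu => //; exact: (leq_trans _ n3).
have dcos : is_derive t 1 (cos \o v) (- sin (v t) * dv) by exact: is_derive1_comp.
have dsin : is_derive t 1 (sin \o v) (cos (v t) * dv) by exact: is_derive1_comp.
transitivity (\row_(i < n)
    (du * tangent_u (u t) (v t) i.+1 + dv * tangent_v (u t) (v t) i.+1)).
  apply: is_derive1_row => i; under eq_fun do rewrite mxE.
  rewrite /tangent_u /tangent_v.
  have [_|i1] := eqVneq i.+1 1%N.
    apply: is_derive_eq (is_deriveM dx1 dcos) _.
    by rewrite /GRing.scale/=; ring.
  have [_|i2] := eqVneq i.+1 2%N.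
    apply: is_derive_eq (is_deriveM dx1 dsin) _.
    by rewrite /GRing.scale/=; ring.
  have [_|ni] := eqVneq i.+1 n.
    apply: is_derive_eq (is_deriveD (is_derive_cst xn0 t 1) (is_deriveZ c dvt)) _.
    by rewrite /GRing.scale/=; ring.
  apply: is_derive_eq (dxu i.+1 _ i2) _; last by ring.
  by apply/andP; split=> //; rewrite ltn_neqAle ni ltn_ord.
by apply/rowP => i; rewrite !mxE.
Qed.

Lemma partial_u_helicoidal (w z : R) : derivable_profile w ->
  partial_u (helicoidal n x xn0 c) w z = \row_(i < n) tangent_u w z i.+1.
Proof.
move=> dx; rewrite /partial_u.
rewrite (helicoidal_chain id (cst z) w 1 0 dx (is_derive_id w 1)
  (is_derive_cst z w 1)).
by rewrite scale1r scale0r addr0.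
Qed.

Lemma partial_v_helicoidal (w z : R) : derivable_profile w ->
  partial_v (helicoidal n x xn0 c) w z = \row_(i < n) tangent_v w z i.+1.
Proof.
move=> dx; rewrite /partial_v.
rewrite (helicoidal_chain (cst w) id z 0 1 dx (is_derive_cst w z 1)
  (is_derive_id z 1)).
by rewrite scale1r scale0r add0r.
Qed.

Let n1 : (1 == n) = false. Proof. by apply/negbTE; rewrite neq_ltn (leq_trans _ n3). Qed.
Let n2 : (2 == n) = false. Proof. by apply/negbTE; rewrite neq_ltn n3. Qed.

(* Qualified because [coefE] also names a rewriting rule of the polynomial library. *)
Lemma coefE_helicoidal (w z : R) : derivable_profile w ->
  Defs.coefE (helicoidal n x xn0 c) w z =
  derive1 (x 1%N) w ^+ 2 + \sum_(3 <= k < n) derive1 (x k) w ^+ 2.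
Proof.
move=> dx; rewrite /Defs.coefE partial_u_helicoidal// lorentz_row//.
rewrite (eq_big_nat _ _ (F2 := fun k => derive1 (x k) w ^+ 2)) => [|k /andP[k3 kn]].
  rewrite /tangent_u /= eqxx ![n == _]eq_sym n1 n2.
  (* The factor [1], written as [cos^2 + sin^2], makes the identity polynomial. *)
  by rewrite -[X in _ = X + _]mulr1 -(cos2Dsin2 z); ring.
by rewrite /tangent_u (gtn_eqF (leq_trans (isT : 1 < 3) k3)%N) (gtn_eqF k3) (ltn_eqF kn) expr2.
Qed.

(** Radial and angular directions are orthogonal in the rotation plane, and the translation by [c]
    acts on the last coordinate, which is constant along meridians. *)
Lemma coefF_helicoidal (w z : R) : derivable_profile w ->
  coefF (helicoidal n x xn0 c) w z = 0.
Proof.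
move=> dx; rewrite /coefF partial_u_helicoidal// partial_v_helicoidal//.
rewrite lorentz_row// big_nat big1 => [|k /andP[k3 kn]].
  by rewrite /tangent_u /tangent_v /= eqxx ![n == _]eq_sym n1 n2; ring.
by rewrite /tangent_v (gtn_eqF (leq_trans (isT : 1 < 3) k3)%N) (gtn_eqF k3) (ltn_eqF kn) mulr0.
Qed.

Lemma coefG_helicoidal (w z : R) : derivable_profile w ->
  coefG (helicoidal n x xn0 c) w z = x 1%N w ^+ 2 - c ^+ 2.
Proof.
move=> dx; rewrite /coefG partial_v_helicoidal//.
rewrite lorentz_row// big_nat big1 => [|k /andP[k3 kn]].
  rewrite /tangent_v /= eqxx ![n == _]eq_sym n1 n2.
  by rewrite -[X in _ = X - _]mulr1 -(cos2Dsin2 z); ring.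
by rewrite /tangent_v (gtn_eqF (leq_trans (isT : 1 < 3) k3)%N) (gtn_eqF k3) (ltn_eqF kn) mulr0.
Qed.

Lemma velocity_helicoidal (u v : R -> R) (t : R) :
  derivable_profile (u t) -> derivable u t 1 -> derivable v t 1 ->
  derive1 (fun s => helicoidal n x xn0 c (u s) (v s)) t =
  derive1 u t *: partial_u (helicoidal n x xn0 c) (u t) (v t) +
  derive1 v t *: partial_v (helicoidal n x xn0 c) (u t) (v t).
Proof.
move=> dx du dv; rewrite partial_u_helicoidal// partial_v_helicoidal//.
by apply: (helicoidal_chain _ _ _ _ _ dx); rewrite derive1E; exact/derivableP.
Qed.

End HelicoidalTangent.

(** * The angle with the meridians *)

(** As [X] is spacelike, only the [sinh] alternative of [lorentz_angle] is possible; squaring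
    removes its sign and both norms, and [cosh^2 = 1 + sinh^2] gives the stated form. *)
Lemma spacelike_meridian_angle (R : realType) (n : nat) (X Y : 'rV[R]_n)
    (a b g phi : R) :
  lorentz X X = 1 -> lorentz X Y = 0 -> lorentz Y Y = - g ->
  timelike (a *: X + b *: Y) -> lorentz_angle X (a *: X + b *: Y) phi ->
  a ^+ 2 * cosh phi ^+ 2 = g * b ^+ 2 * sinh phi ^+ 2.
Proof.
move=> XX XY YY tl [_ ang].
set V := a *: X + b *: Y in tl ang.
have XV : lorentz X V = a by rewrite lorentzDZr XX XY; ring.
have VV : lorentz V V = a ^+ 2 - g * b ^+ 2.
  rewrite lorentzDZr lorentzC XV (lorentzC V Y) lorentzDZr (lorentzC Y X) XY YY.
  ring.
have normX : lorentz_norm X = 1 by rewrite /lorentz_norm XX normr1 sqrtr1.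
have normV : lorentz_norm V ^+ 2 = g * b ^+ 2 - a ^+ 2.
  rewrite /lorentz_norm sqr_sqrtr ?normr_ge0// ltr0_norm// VV; ring.
have a2 : a ^+ 2 = (g * b ^+ 2 - a ^+ 2) * sinh phi ^+ 2.
  case: ang => [[_ [_ [_]]]|[]]; last by rewrite /timelike XX ltr10.
  by rewrite XV normX mul1r -normV => -[->|->]; ring.
have -> : cosh phi ^+ 2 = 1 + sinh phi ^+ 2 by rewrite -(cosh2Bsinh2 phi); ring.
by rewrite mulrDr mulr1 {1}a2; ring.
Qed.

Lemma sqr_eq_abs_root (R : realType) (q k g : R) : 0 < k -> 0 < g ->
  g * q ^+ 2 = k ^+ 2 -> `|q| = k * (Num.sqrt g)^-1.
Proof.
move=> k0 g0 gq; have sg : 0 < Num.sqrt g by rewrite sqrtr_gt0.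
apply/eqP; rewrite -(@eqrXn2 _ 2%N)//; last by rewrite divr_ge0 ?ltW.
rewrite real_normK ?num_real// exprMn exprVn sqr_sqrtr ?(ltW g0)// -gq.
by rewrite mulrAC mulfV ?mul1r// gt_eqF.
Qed.

(** * The differential equation of the loxodrome and its integration *)

Theorem corollary3p3 (R : realType) (n : nat) (hn : (3 <= n)%N)
  (I : set R) (hI : open_interval I)
  (x : nat -> R -> R) (xn0 c eps : R)
  (hc : c != 0) (heps : eps = 1 \/ eps = -1)
  (hprofile : arclength_profile n x xn0 I eps)
  (hsurface : timelike_surface (helicoidal n x xn0 c) I)
  (T : set R) (u v : R -> R) (phi0 : R) (hphi0 : 0 < phi0)
  (hlox : timelike_loxodrome (helicoidal n x xn0 c) I T u v phi0)
  (hu' : forall t, T t -> derive1 u t != 0)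
  (u0 : R) (hu0 : (u @` T) u0) :
  exists (tau : R -> R) (s v0 : R),
    [/\ open_interval (u @` T),
        change_of_parameter T (u @` T) u tau,
        s = 1 \/ s = -1
      & forall w, (u @` T) w ->
          helicoidal n x xn0 c (u (tau w)) (v (tau w)) =
          helicoidal n x xn0 c w
            (v0 + s * coth phi0 *
               oriented_integral u0 w
                 (fun xi => (Num.sqrt (c ^+ 2 - x 1%N xi ^+ 2))^-1))].
Proof.
have [hT [su sv] uI tl ang] := hlox; have [_ iT _] := hT.
have [sp _ unit_speed] := hprofile.
have dx w : I w -> derivable_profile n x w.
  exact: smooth_derivable_profile sp.
have cx w : I w -> {for w, continuous (x 1%N)}.
  move=> Iw; apply/derivable_continuous_at/dx => //.
  exact: (leq_trans _ hn).
have E_eps w z : I w -> Defs.coefE (helicoidal n x xn0 c) w z = eps.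
  by move=> Iw; rewrite coefE_helicoidal ?unit_speed//; exact: dx.
have [t0 Tt0 _] := hu0.
have eps1 : eps = 1.
  case: heps => // epsN1; have := unit_speed _ (uI _ Tt0).
  rewrite epsN1 => e; have : 0 <= -1 :> R.
    by rewrite -e addr_ge0 ?sqr_ge0// sumr_ge0// => k _; rewrite sqr_ge0.
  by rewrite oppr_ge0 ler10.
pose g w := c ^+ 2 - x 1%N w ^+ 2.
have g0 w : I w -> 0 < g w.
  move=> Iw; have := hsurface w 0 Iw.
  rewrite E_eps// coefF_helicoidal ?coefG_helicoidal//; try exact: dx.
  by rewrite eps1 /g => h; lra.
pose k := coth phi0.
have sh0 := sinh_gt0 _ hphi0.
have k0 : 0 < k by rewrite divr_gt0// cosh_gt0.
(* The slope [dv/du], still as a function of the original parameter. *)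
pose q t := derive1 v t / derive1 u t.
have q_abs t : T t -> `|q t| = k * (Num.sqrt (g (u t)))^-1.
  move=> Tt; have Iut := uI _ Tt; apply: sqr_eq_abs_root => //; first exact: g0.
  have vel : derive1 (fun s => helicoidal n x xn0 c (u s) (v s)) t =
      derive1 u t *: partial_u (helicoidal n x xn0 c) (u t) (v t) +
      derive1 v t *: partial_v (helicoidal n x xn0 c) (u t) (v t).
    exact: velocity_helicoidal (dx _ Iut) (su 0%N _ Tt) (sv 0%N _ Tt).
  have := ang _ Tt; have := tl _ Tt; rewrite /= vel => tlt angt.
  have e := spacelike_meridian_angle _ _ _ _ _ _ (g (u t)) _
    (etrans (E_eps _ _ Iut) eps1) (coefF_helicoidal _ _ _ _ hn _ _ (dx _ Iut))
    (etrans (coefG_helicoidal _ _ _ _ hn _ _ (dx _ Iut)) (esym (opprB _ _)))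
    tlt angt.
  have u'0 := hu' _ Tt; rewrite /q /k /coth (expr_div_n (derive1 v t)) (expr_div_n (cosh phi0)).
  apply/eqP; rewrite mulrA eqr_div ?expf_neq0 ?(lt0r_neq0 sh0)//.
  by rewrite -e mulrC.
(* Second-order smoothness enters here: [sv 1] and [su 1] say that [v'] and [u'] are derivable,
   hence continuous. *)
have cq t : T t -> {for t, continuous q}.
  move=> Tt; apply: continuousM; last apply: continuousV.
  - by apply: derivable_continuous_at; exact: (sv 1%N).
  - exact: hu'.
  - by apply: derivable_continuous_at; exact: (su 1%N).
have q0 t : T t -> q t != 0.
  move=> Tt; rewrite -normr_gt0 q_abs// mulr_gt0// invr_gt0 sqrtr_gt0.
  exact/g0/uI.
have [s s1 qE] : exists2 s : R, s = 1 \/ s = -1 &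
    forall t, T t -> q t = s * k * (Num.sqrt (g (u t)))^-1.
  case: (interval_constant_sign _ _ iT cq q0) => qs.
    exists 1; [by left|move=> t Tt].
    by rewrite mul1r -q_abs// gtr0_norm ?qs.
  exists (-1); [by right|move=> t Tt].
  by rewrite mulN1r mulNr -q_abs// ltr0_norm ?qs// opprK.
have [tau [oJ ctau dtau]] := inverse_change_of_parameter _ _ hT su hu'.
have [_ _ tauT JT] := ctau; have [_ iJ _] := oJ.
(* The integral vanishes at [w = u0], so the additive constant is the value of [v] where
   [u = u0]. *)
exists tau, s, (v (tau u0)); split=> // w Jw.
have [_ ->] := JT _ Jw; congr helicoidal.
have sk0 : s * k != 0.
  rewrite mulf_neq0 ?(lt0r_neq0 k0)//.
  by case: s1 => ->; rewrite ?oppr_eq0 oner_neq0.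
(* The derivative of [v] composed with [tau] is [s * k] times the integrand, hence the division by
   [s * k] in the antiderivative. *)
rewrite (oriented_integral_FTC (u @` T) _
  (fun xi => (s * k)^-1 *: v (tau xi)) _ _ iJ _ _ hu0 Jw).
- by rewrite /GRing.scale/= -mulrBr mulVKf// addrC subrK.
- move=> _ [t Tt <-]; have Iut := uI _ Tt.
  apply: continuousV; first by rewrite gt_eqF// sqrtr_gt0; exact: g0.
  apply: (continuous_comp (f := g) (g := Num.sqrt)); last exact: sqrt_continuous.
  apply: continuousB; first exact: cst_continuous.
  apply: (continuous_comp (f := x 1%N) (g := fun y => y ^+ 2)); first exact: cx.
  exact: exprn_continuous.
move=> _ [t Tt <-].
have dv : is_derive (tau (u t)) 1 v (derive1 v t).
  by rewrite (tauT _ Tt).2 derive1E; apply: derivableP; exact: (sv 0%N).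
apply: is_derive_eq (is_deriveZ (s * k)^-1 (is_derive1_comp dv (dtau _ Tt))) _.
by rewrite -/(q t) qE// /GRing.scale/= mulKf.
Qed.
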